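(* Let $\mathcal G$ be a graph from the two-class stochastic block model $\mathrm{SBM}(n,p,q)$ with $n_1$ nodes in class $1$ (the minority class) and $n_2$ nodes in class $2$ (the majority class), where $n_1+n_2=n$ and $n_1\ll n_2$, with intra-class connection probability $p$ and inter-class connection probability $q$. Let $\rho:=n_2/n_1$ be the imbalance ratio. Assume that $n_1\cdot p=\beta+O(1/n)$ (so $\beta$ is the average intra-class node degree of class $1$) and that $p/q=O(1)$. Then for a large $n$ (that is, asymptotically as $n\to\infty$), the ratio of the $k$-hop AMP coefficient $\alpha_1^k$ of the minority class to the $k$-hop AMP coefficient $\alpha_2^k$ of the majority class grows polynomially with the imbalance ratio $\rho$ and exponentially with $k$: $$\frac{\alpha_1^k}{\alpha_2^k}=\left(\rho\cdot\frac{\sum_{t=1}^k(\rho\beta)^{t-1}}{\sum_{t=1}^k\beta^{t-1}}\right)^{2}+O\!\left(\frac1n\right).$$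
   Context: Stochastic block model: $\mathrm{SBM}(n,p,q)$ with two classes is the random graph $\mathcal G=(\mathcal V,\mathcal E)$ on $n$ nodes, where $\mathcal V=\mathcal V_1\sqcup\mathcal V_2$, $|\mathcal V_i|=n_i$ ($\mathcal V_i$ is the set of nodes of class $i$), and each unordered pair of distinct nodes is joined by an edge independently, with probability $p$ if the two nodes are in the same class and with probability $q$ if they are in different classes. Homo-connected neighbors: a node $u$ is homo-connected to a node $v$ if there is a path in $\mathcal G$ from $u$ to $v$ such that all nodes of the path other than the starting node $u$ (that is, all intermediate nodes and $v$) belong to the same class; the class of $u$ itself is unrestricted. $\mathcal H(u,k)$ denotes the set of $k$-hop homo-connected neighbors of $u$, i.e. the nodes $v\ne u$ for which there is such a path with at most $k$ edges. AMP (ambivalent message-passing) coefficient of a class: for $i\in\{1,2\}$, $$\alpha_i^k:=\frac{\mathbb E_{u\in\mathcal V_i}\big[\,|\{v: v\notin\mathcal V_i,\ v\in\mathcal H(u,k)\}|\,\big]}{\mathbb E_{u\in\mathcal V_i}\big[\,|\{v: v\in\mathcal V_i,\ v\in\mathcal H(u,k)\}|\,\big]},$$ where $u$ is a node of class $i$ and the expectation is over the random graph.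
   Formalization: The imbalance ratio ρ is assumed bounded as n→∞ (for k=1 the formula fails if ρ→∞), and p/q=O(1) is taken as p/q of constant order, bounded above and below (with q=1, p=β/n₁, k≥2 the formula fails); n₁≪n₂ is relaxed to n₁<n₂. *)

(* Defs.v *)
From HB Require Import structures.
From mathcomp Require Import all_boot all_order all_algebra all_fingroup.

Set Implicit Arguments.
Unset Strict Implicit.
Unset Printing Implicit Defensive.

Import Order.TTheory GRing.Theory Num.Theory.
Local Open Scope ring_scope.

(* Unordered pairs of distinct nodes.  A simple graph on T is an arbitrary set
   of such pairs. *)
Definition edge (T : finType) := {e : {set T} | #|e| == 2%N}.
HB.instance Definition _ (T : finType) := Finite.on (edge T).

Notation graph T := {set (edge T)}.

Definition adj (T : finType) (G : graph T) : rel T :=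
  [rel u v | [exists e in G, val e == [set u; v]]].

Section HomoConnected.
Variables (T : finType) (C : eqType) (c : T -> C).

Definition class_set (i : C) : {set T} := [set u | c u == i].

(* u :: s is a path with at most k edges; its starting node u is the only node
   on which no class condition is imposed. *)
Definition homo_connected (G : graph T) (k : nat) (u v : T) : bool :=
  [exists s : k.-bseq T,
    [&& path (adj G) u s, uniq (u :: s), last u s == v
      & all [pred w | c w == c v] s]].

Definition homo_nbrs (G : graph T) (u : T) (k : nat) : {set T} :=
  [set v | (v != u) && homo_connected G k u v].

End HomoConnected.

Section SBM.
Variables (R : numFieldType) (T : finType) (C : eqType) (c : T -> C).
Variables (p q : R).

Definition edge_prob (e : edge T) : R :=
  if [forall u in val e, forall v in val e, c u == c v] then p else q.

Definition sbm_weight (G : graph T) : R :=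
  \prod_(e : edge T) (if e \in G then edge_prob e else 1 - edge_prob e).

Definition sbm_expect (X : graph T -> R) : R :=
  \sum_(G : graph T) sbm_weight G * X G.

(* Mean over the random graph and over u uniform in class i.  By symmetry the
   mean over u has no effect (class_meanE below), so that this is also the
   expectation for any fixed node u of class i. *)
Definition class_mean (i : C) (X : T -> graph T -> R) : R :=
  (\sum_(u in class_set c i) sbm_expect (X u)) / #|class_set c i|%:R.

Definition out_count (i : C) (k : nat) (u : T) (G : graph T) : R :=
  #|homo_nbrs c G u k :\: class_set c i|%:R.

Definition in_count (i : C) (k : nat) (u : T) (G : graph T) : R :=
  #|homo_nbrs c G u k :&: class_set c i|%:R.

Definition amp (i : C) (k : nat) : R :=
  class_mean i (out_count i k) / class_mean i (in_count i k).

Lemma sbm_weight_sum1 : \sum_(G : graph T) sbm_weight G = 1.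
Proof.
have -> : 1 = \prod_(e : edge T) (edge_prob e + (1 - edge_prob e)) :> R.
  by rewrite big1 // => e _; rewrite addrC subrK.
by rewrite bigA_distr.
Qed.

Section Invariance.
Variable s : {perm T}.
Hypothesis cs : forall x, c (s x) = c x.

Fact emap_subproof (t : {perm T}) (e : edge T) : #|t @: val e| == 2%N.
Proof. by rewrite (card_imset _ (@perm_inj _ t)) (valP e). Qed.

Definition emap (t : {perm T}) (e : edge T) : edge T :=
  exist (fun e : {set T} => #|e| == 2%N) _ (emap_subproof t e).

Lemma val_emap t e : val (emap t e) = t @: val e. Proof. by []. Qed.

Lemma emapK : cancel (emap s) (emap s^-1%g).
Proof.
move=> e; apply: val_inj; rewrite !val_emap -imset_comp.
by rewrite (eq_imset (g := id)) ?imset_id // => x /=; rewrite permK.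
Qed.

Lemma emapVK : cancel (emap s^-1%g) (emap s).
Proof.
move=> e; apply: val_inj; rewrite !val_emap -imset_comp.
by rewrite (eq_imset (g := id)) ?imset_id // => x /=; rewrite permKV.
Qed.

Definition gmap (G : graph T) : graph T := emap s @: G.

Lemma mem_gmap e G : (emap s e \in (gmap G : {set _})) = (e \in G).
Proof. by rewrite mem_imset //; exact: can_inj emapK. Qed.

Lemma gmap_bij : bijective gmap.
Proof.
exists (fun G : graph T => emap s^-1%g @: G) => G; rewrite /gmap -imset_comp.
  by rewrite (eq_imset (g := id)) ?imset_id // => e /=; rewrite emapK.
by rewrite (eq_imset (g := id)) ?imset_id // => e /=; rewrite emapVK.
Qed.

Lemma edge_prob_emap e : edge_prob (emap s e) = edge_prob e.
Proof.
rewrite /edge_prob; congr (if _ then _ else _).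
apply/'forall_implyP/'forall_implyP => H u ue; apply/'forall_implyP => v ve.
  have /'forall_implyP/(_ (s v)) := H (s u) (imset_f s ue).
  by rewrite !cs; apply; apply: imset_f.
have [u' u'e ->] := imsetP ue; have [v' v'e ->] := imsetP ve.
by rewrite !cs; move: (H u' u'e) => /'forall_implyP; apply.
Qed.

Lemma sbm_weight_gmap G : sbm_weight (gmap G) = sbm_weight G.
Proof.
rewrite /sbm_weight (reindex (emap s)) /=; last first.
  by exists (emap s^-1%g) => e _; [exact: emapK | exact: emapVK].
by apply: eq_bigr => e _; rewrite mem_gmap edge_prob_emap.
Qed.

Lemma adj_gmap G u v : adj (gmap G) (s u) (s v) = adj G u v.
Proof.
have E e : (val (emap s e) == [set s u; s v]) = (val e == [set u; v]).
  rewrite val_emap -!imset_set1 -imsetU.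
  by apply/eqP/eqP => [/(imset_inj (@perm_inj _ s)) | ->].
apply/existsP/existsP => -[e /andP[eG ee]].
  exists (emap s^-1%g e); rewrite -mem_gmap -E emapVK eG; exact: ee.
by exists (emap s e); rewrite mem_gmap eG E.
Qed.

Lemma homo_connected_gmap G k u v :
  homo_connected c (gmap G) k (s u) (s v) = homo_connected c G k u v.
Proof.
apply/existsP/existsP => -[t /and4P[pt ut /eqP lt at_]].
  have ht : (size (map s^-1%g t) <= k)%N by rewrite size_map size_bseq.
  have tE : (t : seq T) = map s (map s^-1%g t).
    by rewrite -map_comp map_id_in // => x _ /=; rewrite permKV.
  move: pt ut lt at_; rewrite tE => pt ut lt at_; exists (Bseq ht) => /=.
  apply/and4P; split.
  - by move: pt; rewrite path_map (eq_path (adj_gmap G)).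
  - by move: ut; rewrite -map_cons (map_inj_uniq (@perm_inj _ s)).
  - by apply/eqP/(@perm_inj _ s); rewrite -lt last_map.
  - by move: at_; rewrite all_map; apply: sub_all => x /=; rewrite !cs.
have ht : (size (map s t) <= k)%N by rewrite size_map size_bseq.
exists (Bseq ht) => /=; apply/and4P; split.
- by rewrite path_map (eq_path (adj_gmap G)).
- by move: ut; rewrite -(map_inj_uniq (@perm_inj _ s) (u :: t)).
- by rewrite last_map lt.
- by rewrite all_map; apply: sub_all at_ => x /=; rewrite !cs.
Qed.

Lemma homo_nbrs_gmap G u k :
  homo_nbrs c (gmap G) (s u) k = s @: homo_nbrs c G u k.
Proof.
apply/setP => v; rewrite -[v](permKV s) (mem_imset _ _ (@perm_inj _ s)) !inE.
by rewrite homo_connected_gmap (inj_eq (@perm_inj _ s)).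
Qed.

Lemma class_set_perm i : s @: class_set c i = class_set c i.
Proof.
apply/setP => v; rewrite -[v](permKV s) (mem_imset _ _ (@perm_inj _ s)) !inE.
by rewrite cs.
Qed.

Lemma sbm_expect_perm (X : T -> graph T -> R) u :
  (forall v G, X (s v) (gmap G) = X v G) ->
  sbm_expect (X (s u)) = sbm_expect (X u).
Proof.
move=> HX; rewrite /sbm_expect (reindex gmap) /=; last exact: onW_bij gmap_bij.
by apply: eq_bigr => G _; rewrite sbm_weight_gmap HX.
Qed.

Lemma out_count_gmap i k v G : out_count i k (s v) (gmap G) = out_count i k v G.
Proof.
rewrite /out_count homo_nbrs_gmap.
suff -> : (s @: homo_nbrs c G v k) :\: class_set c i =
          s @: (homo_nbrs c G v k :\: class_set c i).
  by rewrite card_imset //; exact: perm_inj.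
apply/setP => w; rewrite -[w](permKV s) in_setD !(mem_imset _ _ (@perm_inj _ s)).
by rewrite !inE cs.
Qed.

Lemma in_count_gmap i k v G : in_count i k (s v) (gmap G) = in_count i k v G.
Proof.
rewrite /in_count homo_nbrs_gmap.
suff -> : (s @: homo_nbrs c G v k) :&: class_set c i =
          s @: (homo_nbrs c G v k :&: class_set c i).
  by rewrite card_imset //; exact: perm_inj.
apply/setP => w; rewrite -[w](permKV s) in_setI !(mem_imset _ _ (@perm_inj _ s)).
by rewrite !inE cs.
Qed.

End Invariance.

Lemma class_mean_inv i (X : T -> graph T -> R) u :
  (forall s : {perm T}, (forall x, c (s x) = c x) ->
     forall v G, X (s v) (gmap s G) = X v G) ->
  c u = i -> class_mean i X = sbm_expect (X u).
Proof.
move=> HX cu; rewrite /class_mean.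
have ui : u \in class_set c i by rewrite inE cu.
rewrite (eq_bigr (fun=> sbm_expect (X u))) => [|v].
  rewrite sumr_const -[_ *+ _]mulr_natr mulfK // pnatr_eq0 -lt0n.
  by apply/card_gt0P; exists u.
rewrite inE => /eqP cv.
have cs x : c (tperm u v x) = c x by case: tpermP => // ->; rewrite cu cv.
by rewrite -(sbm_expect_perm cs u (HX _ cs)) tpermL.
Qed.

Lemma class_meanE i k u : c u = i ->
  class_mean i (out_count i k) = sbm_expect (out_count i k u) /\
  class_mean i (in_count i k) = sbm_expect (in_count i k u).
Proof.
move=> cu; split; apply: class_mean_inv => // s cs v G.
- exact: out_count_gmap.
- exact: in_count_gmap.
Qed.

End SBM.

Definition class1 : 'I_2 := ord0.
Definition class2 : 'I_2 := ord_max.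

(* Main.v *)
Require Import Defs.
From mathcomp Require Import all_boot all_order all_algebra.
From mathcomp Require Import ring lra zify.

(** For fixed [u], the number of nodes [v] of class [j] in [H(u,k)] is at most the
number of simple paths of at most [k] edges that leave [u], stay in class [j] and
are present in the graph, and by inclusion-exclusion at least that number minus
the number of pairs of such paths with a common endpoint.  A path of [l + 1] edges
is present with probability [w p^l], where [w] is [p] or [q], and there are
[N ^_ l.+1] of them, [N] being [n_j] or [n_j - 1].  If a path [s] is present and
its edges are considered free of charge, the total weight of the paths with the
same endpoints that leave [s] is [O(max p q)]: each visited vertex outside [s] costs a factor
[max p q], which its [O(n)] choices compensate, and coming back to [s] costs one
more factor.  Hence each of the four expectations is
[w n_j (1 + n_j p + ... + (n_j p)^(k-1)) (1 + O(1/n))].  The factors [p] and [q]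
cancel in the quotient of quotients, and what is left is a Lipschitz function of
[n_1 p]. *)

Set Implicit Arguments.
Unset Strict Implicit.
Unset Printing Implicit Defensive.

Import Order.TTheory GRing.Theory Num.Theory.
Local Open Scope ring_scope.

(** * Simple paths as sets of edges *)

Section Paths.
Variable T : finType.
Implicit Types (E G : graph T) (x y : T) (s : seq T).

Lemma edge_pairP x y : x != y -> {e : edge T | val e = [set x; y]}.
Proof.
move=> xy; have h : #|[set x; y]| == 2%N by rewrite cards2 xy.
by exists (exist (fun e : {set T} => #|e| == 2%N) _ h).
Qed.

(** The comprehension avoids a proof of [x != y]: it is a singleton when the two vertices differ and
    empty otherwise. *)
Fixpoint path_edges x s : graph T :=
  if s is y :: r then [set e | val e == [set x; y]] :|: path_edges y r else set0.

Lemma path_edges_vertices x s e : e \in path_edges x s -> val e \subset x :: s.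
Proof.
elim: s x => [|y r IH] x /=; first by rewrite inE.
rewrite !inE => /orP[/eqP ->|/IH /subset_trans -> //].
  by apply/subsetP => z; rewrite !inE => /orP[] /eqP ->; rewrite eqxx ?orbT.
by apply/subsetP => z zr; rewrite in_cons zr orbT.
Qed.

Lemma adj_path_edges x s y z :
  adj (path_edges x s) y z -> (y \in x :: s) && (z \in x :: s).
Proof.
case/existsP=> e /andP[/path_edges_vertices/subsetP sub /eqP ee].
by rewrite !sub // ee !inE eqxx ?orbT.
Qed.

Lemma adj_subset G x y : x != y -> adj G x y = ([set e | val e == [set x; y]] \subset G).
Proof.
move=> xy; have [e ee] := edge_pairP xy; apply/existsP/subsetP.
  case=> f /andP[fG /eqP ff] g; rewrite inE => /eqP gg.
  by rewrite (_ : g = f) //; apply: val_inj; rewrite gg.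
by move=> sub; exists e; rewrite sub ?inE ee eqxx.
Qed.

Lemma path_subset G x s : uniq (x :: s) -> path (adj G) x s = (path_edges x s \subset G).
Proof.
elim: s x => [|y r IH] x /=; first by rewrite sub0set.
rewrite inE negb_or -andbA => /and3P[xy _ u].
by rewrite subUset IH // adj_subset.
Qed.

(** The first edge of [s] is its only edge at [x], so [t] starts with it; as [t] never returns to
    [x], induction applies to the tails. Hence another simple path with the same ends uses an edge
    outside [s]. *)
Lemma path_edges_inj x s t : uniq (x :: s) -> uniq (x :: t) ->
  last x s = last x t -> path (adj (path_edges x s)) x t -> t = s.
Proof.
elim: s x t => [|y r IH] x [|z t] //.
- by move=> _ _ _ /= /andP[/existsP[e]]; rewrite inE.
- by move=> /= /andP[xs _] _ xl; move: xs; rewrite -{1}xl mem_last.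
move=> us ut /= lastE /andP[xz pt].
have [/= xs us'] := andP us; have [/= xt ut'] := andP ut.
have sub_adj a b : a != x -> b != x -> adj (path_edges x (y :: r)) a b ->
    adj (path_edges y r) a b.
  move=> ax bx /existsP[e /andP[]]; rewrite !inE => /orP[/eqP e1 /eqP ee|ey ee].
    have : x \in [set a; b] by rewrite (etrans (esym ee) e1) !inE eqxx.
    by rewrite !inE => /orP[] /eqP xE; [move: ax|move: bx]; rewrite xE eqxx.
  by apply/existsP; exists e; rewrite ey.
have zy : z = y.
  case/existsP: xz => e /andP[]; rewrite !inE => /orP[/eqP e1 /eqP ee|ey /eqP ee].
    have : z \in [set x; y] by rewrite (etrans (esym e1) ee) !inE eqxx orbT.
    by rewrite !inE => /orP[] /eqP // zx; move: xt; rewrite zx mem_head.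
  have /subsetP/(_ x) := path_edges_vertices ey.
  by rewrite ee !inE eqxx => /(_ isT) xs'; move: xs; rewrite inE xs'.
rewrite zy in xt ut' pt lastE *; congr (_ :: _); apply: (IH y) => //.
apply: (@sub_in_path _ (predC1 x)) pt => [a b|]; first exact: sub_adj.
by apply/allP => a at_; rewrite /= (memPn xt).
Qed.

End Paths.

(** * Sums over tuples and bounded sequences *)

Lemma big_tuple0 (R : Type) (idx : R) (op : Monoid.com_law idx)
    (T : finType) (P : pred (seq T)) (f : seq T -> R) :
  \big[op/idx]_(t : 0.-tuple T | P t) f t = if P [::] then f [::] else idx.
Proof.
rewrite big_mkcond (big_pred1 [tuple]) // => t.
by rewrite [t]tuple0; apply/esym/eqP.
Qed.

Lemma big_tuple_cons (R : Type) (idx : R) (op : Monoid.com_law idx)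
    (T : finType) l (P : pred (seq T)) (f : seq T -> R) :
  \big[op/idx]_(t : l.+1.-tuple T | P t) f t =
  \big[op/idx]_y \big[op/idx]_(t : l.-tuple T | P (y :: t)) f (y :: t).
Proof.
rewrite pair_big_dep (reindex (fun z : T * l.-tuple T => [tuple of z.1 :: z.2])) //=.
exists (fun t => (thead t, [tuple of behead t])) => [[y t] _|t _] /=.
  by congr (_, _); apply: val_inj.
by rewrite -tuple_eta.
Qed.

Lemma big_bseq (R : Type) (idx : R) (op : Monoid.com_law idx)
    (T : finType) k (P : pred (seq T)) (f : seq T -> R) :
  \big[op/idx]_(s : k.-bseq T | P s) f s =
  \big[op/idx]_(l < k.+1) \big[op/idx]_(t : l.-tuple T | P t) f t.
Proof.
rewrite sig_big_dep (reindex bseq_tagged_tuple) //=.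
exact: onW_bij bseq_tagged_tuple_bij.
Qed.

(** * Weighted walks and free edges *)

Section Walks.
Variables (R : realFieldType) (T : finType).
Implicit Types (E G : graph T) (x y : T) (s : seq T) (g : T -> T -> R).

Fixpoint walk_weight g x s : R :=
  if s is y :: r then g x y * walk_weight g y r else 1.

Lemma walk_weight_ge0 g x s : (forall y z, 0 <= g y z) -> 0 <= walk_weight g x s.
Proof. by move=> g0; elim: s x => [|y r IH] x //=; rewrite mulr_ge0. Qed.

Lemma le_walk_weight g1 g2 x s : (forall y z, 0 <= g1 y z <= g2 y z) ->
  walk_weight g1 x s <= walk_weight g2 x s.
Proof.
move=> g12; elim: s x => [|y r IH] x //=; have /andP[g10 gle] := g12 x y.
apply: ler_pM => //; apply: walk_weight_ge0 => z z'.
by have /andP[] := g12 z z'.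
Qed.

(** No vertex repeats, so the edges of the path are distinct and each enters the product once. *)
Lemma prod_path_edges g (h : edge T -> R) x s :
  (forall e y z, val e = [set y; z] -> h e = g y z) -> uniq (x :: s) ->
  \prod_(e in path_edges x s) h e = walk_weight g x s.
Proof.
move=> hg; elim: s x => [|y r IH] x /=; first by rewrite big_set0.
rewrite inE negb_or -andbA => /and3P[xy xr u].
have [e ee] := edge_pairP xy.
have -> : [set e0 : edge T | val e0 == [set x; y]] = [set e].
  by apply/setP => f; rewrite !inE -ee (inj_eq val_inj).
rewrite big_setU1 /= ?IH ?(hg _ _ _ ee) //.
apply/negP => /path_edges_vertices/subsetP/(_ x).
by rewrite ee !inE eqxx (negPf xy) (negPf xr) => /(_ isT).
Qed.

Section FreeEdges.
Variables (E : graph T) (V : {set T}) (v : T) (b M : R).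
Hypotheses (EV : forall x y, adj E x y -> (x \in V) && (y \in V)) (vV : v \in V).
Hypotheses (b01 : 0 <= b <= 1) (bM : #|T|%:R * b <= M).

(** In the application [E] is a path known to be present and [V] its vertex set. [W] weighs all
    walks of [l] steps from [x] to [v], [D] only those with a step outside [E]. *)
Let g x y : R := if adj E x y then 1 else b.
Let W l x := \sum_(t : l.-tuple T | last x t == v) walk_weight g x t.
Let D l x := \sum_(t : l.-tuple T | (last x t == v) && ~~ path (adj E) x t)
  walk_weight g x t.
Let L : R := #|V|%:R.

Let b_ge0 : 0 <= b. Proof. by case/andP: b01. Qed.
Let b_le1 : b <= 1. Proof. by case/andP: b01. Qed.
Let L_ge0 : 0 <= L. Proof. exact: ler0n. Qed.
Let M_ge0 : 0 <= M. Proof. by apply: le_trans bM; rewrite mulr_ge0. Qed.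
Let g01 x y : 0 <= g x y <= 1.
Proof. by rewrite /g; case: ifP => _ //; rewrite ler01 lexx. Qed.
Let weight_ge0 x s : 0 <= walk_weight g x s.
Proof. by apply: walk_weight_ge0 => y z; have /andP[] := g01 y z. Qed.
Let LM_ge0 : 0 <= L + M. Proof. by rewrite addr_ge0. Qed.

(* Every visit outside [V] costs a factor [b], which makes [sum_a] bounded. *)
Let a y : R := if y \in V then 1 else b.

Let a_ge0 y : 0 <= a y. Proof. by rewrite /a; case: ifP. Qed.
Let a_ge_b y : b <= a y. Proof. by rewrite /a; case: ifP. Qed.

Let sum_a : \sum_y a y <= L + M.
Proof.
rewrite (bigID (mem V)) /= lerD //.
  by rewrite (eq_bigr (fun=> 1)) => [|y yV]; rewrite ?sumr_const // /a yV.
rewrite (eq_bigr (fun=> b)) => [|y /negPf yV]; last by rewrite /a yV.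
rewrite sumr_const -mulr_natl (le_trans _ bM) // ler_wpM2r // ler_nat.
exact: max_card.
Qed.

(** Each step is charged to its source: [g x y <= a x], since a free edge starts in [V]. Summing
    over the next vertex gives one factor [L + M] per step, and [a v = 1] at the end. *)
Lemma sum_walks_le x l : W l x <= (L + M) ^+ l * a x.
Proof.
elim: l x => [|l IH] x.
  rewrite expr0 mul1r /W (big_tuple0 _ (fun s => last x s == v)) /=.
  by case: eqP => [->|_]; rewrite // /a vV.
rewrite /W (big_tuple_cons _ _ (fun s => last x s == v)) /=.
under eq_bigr => y _ do rewrite -mulr_sumr -/(W l y).
apply: (@le_trans _ _ (\sum_y (L + M) ^+ l * a x * a y)).
  apply: ler_sum => y _; rewrite [leRHS]mulrAC [leRHS]mulrC.
  apply: ler_pM (IH y); rewrite ?sumr_ge0 //; first by have /andP[] := g01 x y.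
  by rewrite /g; case: ifP => [/EV/andP[xV _]|_]; rewrite ?a_ge_b // /a xV.
by rewrite -mulr_sumr exprSr [leRHS]mulrAC ler_wpM2l // mulr_ge0 ?exprn_ge0.
Qed.

(** Split at the first step: a free one stays in [V] and induction applies; any other costs [b], and
    [sum_walks_le] bounds the rest. The factor [l] counts the positions of the first deviation. *)
Lemma sum_deviating_walks_le x l : x \in V -> D l x <= b * l%:R * (L + M) ^+ l.
Proof.
elim: l x => [|l IH] x xV.
  by rewrite mulr0 mul0r /D big_pred0 // => t; rewrite tuple0 andbF.
rewrite /D (big_tuple_cons _ _ (fun s => (last x s == v) && ~~ path (adj E) x s)) /=.
have C0 : 0 <= (L + M) ^+ l by rewrite exprn_ge0.
apply: (@le_trans _ _ (\sum_y b * l.+1%:R * (L + M) ^+ l * a y)); last first.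
  by rewrite -mulr_sumr exprSr [leRHS]mulrA ler_wpM2l // !mulr_ge0.
apply: ler_sum => y _; rewrite -mulr_sumr /g; case: ifPn => [xy|_].
  have /andP[_ yV] := EV xy; rewrite mul1r /a yV mulr1.
  apply: le_trans (IH _ yV) _; rewrite ler_wpM2r // ler_wpM2l // ler_nat.
  exact: leqnSn.
have -> : b * l.+1%:R * (L + M) ^+ l * a y = b * ((L + M) ^+ l * a y) * l.+1%:R.
  by ring.
under eq_bigl do rewrite andbT.
rewrite -[leLHS]mulr1; apply: ler_pM; rewrite ?ler1n // ?mulr_ge0 ?sumr_ge0 //.
by rewrite ler_wpM2l // sum_walks_le.
Qed.

End FreeEdges.
End Walks.

Lemma adjE (T : finType) (G : graph T) (e : edge T) x y :
  val e = [set x; y] -> adj G x y = (e \in G).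
Proof.
move=> ee; apply/existsP/idP => [[f /andP[fG /eqP ff]]|eG].
  by rewrite (_ : e = f) //; apply: val_inj; rewrite ee ff.
by exists e; rewrite eG ee eqxx.
Qed.

(** Elements that collide with no other inject into the image; every other element is counted at
    least once by the double sum. *)
Lemma leq_card_imset_collisions (X Y : finType) (A : {set X}) (f : X -> Y) :
  (#|A| <= #|f @: A| + \sum_(s in A) \sum_(t in A | (t != s) && (f t == f s)) 1)%N.
Proof.
pose B := [set s in A | [exists t in A, (t != s) && (f t == f s)]].
rewrite -(cardsID B A) addnC leq_add //.
  rewrite -(card_in_imset (f := f) (D := mem (A :\: B))) ?subset_leq_card //.
    by apply: imsetS; exact: subsetDl.
  move=> s t; rewrite !inE => /andP[sB sA] /andP[_ tA] fst.
  move: sB; rewrite sA /= negb_exists => /forallP/(_ t).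
  by rewrite tA fst eqxx andbT negbK /= => /eqP.
rewrite -sum1_card [leqRHS](big_setID B) /=.
apply: leq_trans (leq_addr _ _); apply: leq_sum => s; rewrite !inE.
case/andP=> _ /andP[_ /existsP[t /andP[tA ts]]].
by rewrite (bigD1 t) //= tA.
Qed.

(** * Path probabilities and expected reach in the block model *)

Section Model.
Variables (R : realFieldType) (T : finType) (C : eqType) (c : T -> C) (p q : R).
Implicit Types (F G : graph T) (x y u : T) (s : seq T).

Let expect := sbm_expect c p q.

Definition pair_prob x y : R := if c x == c y then p else q.

Lemma edge_probE e x y : val e = [set x; y] -> edge_prob c p q e = pair_prob x y.
Proof.
move=> ee; rewrite /edge_prob /pair_prob ee; congr (if _ then _ else _).
apply/idP/idP => [/'forall_implyP/(_ x)|/eqP cxy].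
  by rewrite !inE eqxx => /(_ isT)/'forall_implyP/(_ y); rewrite !inE eqxx orbT; apply.
by apply/'forall_implyP => z; rewrite !inE => /orP[] /eqP ->;
   apply/'forall_implyP => z'; rewrite !inE => /orP[] /eqP ->; rewrite ?cxy.
Qed.

Lemma sbm_expect_sum I (r : seq I) (P : pred I) (X : I -> graph T -> R) :
  expect (fun G => \sum_(i <- r | P i) X i G) = \sum_(i <- r | P i) expect (X i).
Proof.
rewrite /expect /sbm_expect; under eq_bigr do rewrite mulr_sumr.
by rewrite exchange_big.
Qed.

Lemma sbm_expectD (X Y : graph T -> R) :
  expect (fun G => X G + Y G) = expect X + expect Y.
Proof. by rewrite -big_split; apply: eq_bigr => G _; rewrite mulrDr. Qed.

Lemma sbm_expect_subset F :
  expect (fun G => (F \subset G)%:R) = \prod_(e in F) edge_prob c p q e.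
Proof.
(* Absence gets weight 0 on [F], so expanding the product kills the graphs that miss an edge of [F];
   off [F] the two weights add up to 1. *)
pose absent e := if e \in F then 0 else 1 - edge_prob c p q e.
transitivity (\prod_e (edge_prob c p q e + absent e)); last first.
  rewrite [RHS]big_mkcond /=; apply: eq_bigr => e _.
  by rewrite /absent; case: ifP => _; rewrite ?addr0 // addrC subrK.
rewrite bigA_distr /=; apply: eq_bigr => G _; rewrite /sbm_weight.
have [sFG|/subsetPn[e eF eG]] := boolP (F \subset G).
  rewrite mulr1; apply: eq_bigr => e _; case: ifPn => // eG.
  by rewrite /absent (contraNF (subsetP sFG e) eG).
by rewrite mulr0 [RHS](bigD1 e) //= (negPf eG) /absent eF mul0r.
Qed.

Hypotheses (p01 : 0 <= p <= 1) (q01 : 0 <= q <= 1).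

Lemma edge_prob01 e : 0 <= edge_prob c p q e <= 1.
Proof. by rewrite /edge_prob; case: ifP. Qed.

Lemma le_sbm_expect (X Y : graph T -> R) :
  (forall G, X G <= Y G) -> expect X <= expect Y.
Proof.
move=> XY; apply: ler_sum => G _; rewrite ler_wpM2l // prodr_ge0 // => e _.
by have /andP[? ?] := edge_prob01 e; case: ifP; rewrite ?subr_ge0.
Qed.

Section Reach.
Variables (k : nat) (j : C) (u : T).

(** Candidates are chosen independently of the graph, so that sums over them commute with the
    expectation. The empty sequence is left out because [homo_nbrs] excludes [u]. *)
Definition class_paths : {set k.-bseq T} :=
  [set s : k.-bseq T | [&& s != [::] :> seq T, uniq (u :: s) & all (fun x => c x == j) s]].

Lemma homo_nbrs_imset G :
  homo_nbrs c G u k :&: class_set c j =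
  (fun s : k.-bseq T => last u s) @: [set s in class_paths | path (adj G) u s].
Proof.
apply/setP => v; rewrite !inE; apply/idP/imsetP.
  case/andP=> /andP[vu /existsP[s /and4P[ps us /eqP ls cs]]] /eqP cv.
  exists s; rewrite ?ls // !inE ps us andbT; apply/andP; split.
    by apply: contraNneq vu => s0; rewrite -ls s0.
  by rewrite -cv; exact: cs.
case=> s; rewrite !inE => /andP[/and3P[s0 us cs] ps] ->.
have ls : last u s \in (s : seq T).
  by case: (s : seq T) s0 => //= y r _; rewrite mem_last.
have cl := eqP (allP cs _ ls); rewrite cl eqxx andbT; apply/andP; split.
  by apply: contraTneq ls => ->; have /andP[] := us.
by apply/existsP; exists s; rewrite ps us eqxx; move: cs; apply: sub_all => x /=; rewrite cl.
Qed.

(** Only the first edge of a class path can join two classes: all later vertices lie in class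
    [j]. *)
Definition first_prob : R := if c u == j then p else q.

Lemma class_path_prob (s : k.-bseq T) : s \in class_paths ->
  expect (fun G => (path (adj G) u s)%:R) = first_prob * p ^+ (size s).-1.
Proof.
rewrite inE => /and3P[s0 us cs].
rewrite -[LHS]/(\sum_G _ * _); under eq_bigr do rewrite path_subset //.
rewrite [LHS](sbm_expect_subset (path_edges u s)).
rewrite (prod_path_edges (g := pair_prob)) => [|e x y|]; last by [].
  case: (s : seq T) s0 us cs => //= y r _ _ /andP[/eqP cy cr].
  rewrite /pair_prob /first_prob cy; congr (_ * _).
  elim: r y cy cr => [|z r IH] y cy //= /andP[/eqP cz cr].
  by rewrite (IH z) // /pair_prob cy cz eqxx exprS.
exact: edge_probE.
Qed.

(** Both paths are present iff the union of their edges is. Independence splits off the edges of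
    [s]; an edge of [t] then costs 1 if shared with [s] and at most [b] otherwise. *)
Lemma two_paths_prob (b : R) (s t : k.-bseq T) :
  p <= b -> q <= b -> s \in class_paths -> t \in class_paths ->
  expect (fun G => (path (adj G) u s && path (adj G) u t)%:R) <=
  first_prob * p ^+ (size s).-1 *
    walk_weight (fun x y => if adj (path_edges u s) x y then 1 else b) u t.
Proof.
move=> pb qb sP tP; rewrite -(class_path_prob sP).
move: sP tP; rewrite !inE => /and3P[_ us _] /and3P[_ ut _].
set E := path_edges u s.
have -> : expect (fun G => (path (adj G) u s)%:R) = expect (fun G => (E \subset G)%:R).
  by apply: eq_bigr => G _; rewrite path_subset.
have -> : expect (fun G => (path (adj G) u s && path (adj G) u t)%:R) =
    expect (fun G => (E :|: path_edges u t \subset G)%:R).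
  by apply: eq_bigr => G _; rewrite !path_subset // subUset.
rewrite !sbm_expect_subset.
pose h e := if e \in E then 1 else edge_prob c p q e.
have -> : \prod_(e in E :|: path_edges u t) edge_prob c p q e =
    \prod_(e in E) edge_prob c p q e * \prod_(e in path_edges u t) h e.
  rewrite (big_setID E) /= setUK; congr (_ * _).
  rewrite setDUl setDv set0U [RHS](big_setID E) /= [X in _ = X * _]big1 ?mul1r => [|e].
    by apply: eq_bigr => e; rewrite inE /h => /andP[/negPf ->].
  by rewrite inE /h => /andP[_ ->].
rewrite ler_wpM2l //.
  by apply: prodr_ge0 => e _; have /andP[] := edge_prob01 e.
rewrite (prod_path_edges (g := fun x y => if adj E x y then 1 else pair_prob x y)) //.
  apply: le_walk_weight => x y; rewrite /pair_prob.
  by case: ifP => _; rewrite ?ler01 ?lexx //; case: ifP => _; rewrite ?pb ?qb andbT;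
    [case/andP: p01|case/andP: q01].
by move=> e x y ee; rewrite /h (adjE _ ee) (edge_probE ee).
Qed.

(** [S] is the expected number of present class paths, which bounds the number of endpoints from
    above. The lower bound subtracts colliding pairs; [K * b] sums [sum_deviating_walks_le] over the
    lengths, with at most [k.+1] vertices on the first path. *)
Lemma expect_reach_bounds (b M : R) (K := \sum_(l < k.+1) l%:R * (k.+1%:R + M) ^+ l)
    (S := \sum_(s in class_paths) first_prob * p ^+ (size s).-1) :
  p <= b -> q <= b -> b <= 1 -> #|T|%:R * b <= M ->
  S * (1 - K * b) <=
    expect (fun G => #|homo_nbrs c G u k :&: class_set c j|%:R) <= S.
Proof.
move=> pb qb b1 bM; have /andP[p0 _] := p01; have b0 := le_trans p0 pb.
have fp0 : 0 <= first_prob by rewrite /first_prob; case: ifP => _ //; case/andP: q01.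
have SE : S = expect (fun G => \sum_(s in class_paths) (path (adj G) u s)%:R).
  by rewrite sbm_expect_sum; apply: eq_bigr => s sP; rewrite class_path_prob.
pose A G := [set s in class_paths | path (adj G) u s].
have cardA G : \sum_(s in class_paths) (path (adj G) u s)%:R = #|A G|%:R :> R.
  rewrite -sum1_card natr_sum; under [RHS]eq_bigl do rewrite inE.
  by rewrite [RHS]big_mkcondr; apply: eq_bigr => s _; case: path.
have M0 : 0 <= M by apply: le_trans bM; rewrite mulr_ge0.
apply/andP; split; last first.
  rewrite SE; apply: le_sbm_expect => G; rewrite cardA ler_nat homo_nbrs_imset.
  exact: leq_imset_card.
pose collide (s t : k.-bseq T) := (t != s) && (last u t == last u s).
suff H : expect (fun G => \sum_(s in class_paths) \sum_(t in class_paths | collide s t)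
    (path (adj G) u s && path (adj G) u t)%:R) <= S * K * b.
  rewrite mulrBr mulr1 mulrA lerBlDr (le_trans _ (lerD (lexx _) H)) // SE.
  rewrite -sbm_expectD; apply: le_sbm_expect => G; rewrite cardA homo_nbrs_imset -/(A G).
  have := leq_card_imset_collisions (A G) (fun s : k.-bseq T => last u s).
  rewrite -(ler_nat R) natrD => /le_trans -> //; rewrite lerD2l natr_sum.
  under eq_bigl do rewrite inE; rewrite big_mkcondr; apply: ler_sum => s sP.
  rewrite natr_sum; case: ifP => ps; last by rewrite sumr_ge0.
  under eq_bigl do rewrite inE -andbA andbCA; rewrite big_mkcondl.
  by apply: ler_sum => t _; case: path.
rewrite sbm_expect_sum /S -mulrA mulr_suml; apply: ler_sum => s sP.
rewrite sbm_expect_sum.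
apply: (@le_trans _ _ (\sum_(t in class_paths | collide s t) first_prob *
  p ^+ (size s).-1 * walk_weight (fun x y => if adj (path_edges u s) x y then 1 else b) u t)).
  by apply: ler_sum => t /andP[tP _]; exact: two_paths_prob.
rewrite -mulr_sumr ler_wpM2l ?mulr_ge0 ?exprn_ge0 //.
set E := path_edges u s; set g := fun x y => _.
have g0 x y : 0 <= g x y by rewrite /g; case: ifP.
(* By [path_edges_inj] a colliding [t] leaves [E]; the sum is enlarged to all walks that do so. *)
apply: (@le_trans _ _ (\sum_(t : k.-bseq T | (last u t == last u s) &&
    ~~ path (adj E) u t) walk_weight g u t)).
  rewrite big_mkcond [leRHS]big_mkcond /=; apply: ler_sum => t _.
  case: ifP => [/and3P[tP ts /eqP lts]|_]; last first.
    by case: ifP => _; rewrite ?walk_weight_ge0.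
  rewrite lts eqxx /= ifT //; apply: contraNN ts => pt; apply/eqP/val_inj.
  move: sP tP; rewrite !inE => /and3P[_ us _] /and3P[_ ut _].
  exact: path_edges_inj us ut (esym lts) pt.
rewrite (big_bseq _ _ (fun t => (last u t == last u s) && ~~ path (adj E) u t)).
rewrite /K mulr_suml; apply: ler_sum => l _.
pose V : {set T} := [set x in u :: s].
have Vk : #|V|%:R <= k.+1%:R :> R.
  by rewrite ler_nat cardsE (leq_trans (card_size _)) //= ltnS size_bseq.
apply: (@le_trans _ _ (b * l%:R * (#|V|%:R + M) ^+ l)); last first.
  rewrite -mulrA [leRHS]mulrC ler_wpM2l // ler_wpM2l // lerXn2r ?lerD2r //.
    by rewrite nnegrE addr_ge0.
  by rewrite nnegrE addr_ge0.
apply: sum_deviating_walks_le => //.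
- by move=> x y /adj_path_edges; rewrite !inE.
- by rewrite inE mem_last.
- by rewrite b0.
- by rewrite inE mem_head.
Qed.

End Reach.
End Model.

(** * Falling factorials and the number of class paths *)

Lemma ffact_bounds (R : realFieldType) (n N l : nat) (r : R := n%:R) :
  (0 < n)%N -> (n.-1 <= N <= n)%N ->
  r ^+ l * (1 - l%:R ^+ 2 / r) <= (N ^_ l)%:R <= r ^+ l.
Proof.
rewrite {}/r => n0 /andP[nN Nn]; have n0' : 0 < n%:R :> R by rewrite ltr0n.
(* The next factor [N - l] is at least [n - l.+1], and the new relative loss fits because
   [l^2 + (l + 1) <= (l + 1)^2]. *)
elim: l => [|l /andP[lo hi]].
  by rewrite ffactn0 expr0 expr0n mul0r subr0 mulr1 lexx.
rewrite ffactnSr natrM exprSr; apply/andP; split; last first.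
  by rewrite ler_pM // ler_nat; lia.
have [l2n|l2n] := lerP 0 (1 - l%:R ^+ 2 / n%:R :> R); last first.
  apply: (@le_trans _ _ 0); last by rewrite mulr_ge0.
  rewrite mulr_ge0_le0 ?mulr_ge0 ?exprn_ge0 // subr_le0.
  move: l2n; rewrite subr_lt0 => /ltW/le_trans; apply.
  by rewrite ler_pM2r ?invr_gt0 // lerXn2r ?nnegrE ?ler0n // ler_nat.
apply: (@le_trans _ _ (n%:R ^+ l * (1 - l%:R ^+ 2 / n%:R) * (n%:R - l.+1%:R))).
  rewrite -!mulrA ler_wpM2l ?exprn_ge0 //.
  have -> : n%:R - l.+1%:R = n%:R * (1 - l.+1%:R / n%:R) :> R by field; rewrite gt_eqF.
  rewrite [leRHS]mulrCA ler_wpM2l // -natr1.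
  rewrite -subr_ge0; set d := (n%:R)^-1; have d0 : 0 <= d by rewrite invr_ge0.
  rewrite (_ : _ - _ = l%:R ^+ 2 * d * ((l%:R + 1) * d) + l%:R * d); last by ring.
  by rewrite addr_ge0 ?mulr_ge0 ?exprn_ge0 ?addr_ge0.
have nl : n%:R - l.+1%:R <= (N - l)%:R :> R.
  by rewrite lerBlDr -natrD ler_nat; lia.
apply: (@le_trans _ _ (n%:R ^+ l * (1 - l%:R ^+ 2 / n%:R) * (N - l)%:R)).
  by rewrite ler_wpM2l // mulr_ge0 ?exprn_ge0.
by rewrite ler_wpM2r.
Qed.

Section Counting.
Variables (R : realFieldType) (T : finType) (C : eqType) (c : T -> C) (p q : R).
Hypotheses (p01 : 0 <= p <= 1) (q01 : 0 <= q <= 1).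
Variables (k : nat) (j : C) (u : T).

Let w := first_prob c p q j u.
Let N := #|[pred x | (c x == j) && (x != u)]|.

(** A class path of [l.+1] edges is an injective tuple from class [j] minus [u]; its first edge is
    priced [w], the other [l] are priced [p]. *)
Lemma sum_class_paths :
  \sum_(s in class_paths c k j u) w * p ^+ (size s).-1 =
  \sum_(l < k) (N ^_ l.+1)%:R * (w * p ^+ l).
Proof.
under eq_bigl do rewrite inE.
rewrite (big_bseq _ _ (fun s => [&& s != [::], uniq (u :: s) & all (fun x => c x == j) s])
  (fun s => w * p ^+ (size s).-1)) big_ord_recl.
rewrite big_pred0 => [|t]; last by rewrite tuple0.
rewrite [LHS]add0r; apply: eq_bigr => l _; under eq_bigr do rewrite size_tuple /=.
rewrite sumr_const mulr_natl /N; congr (_ *+ _).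
rewrite -(card_uniq_tuples l.+1 [pred x | (c x == j) && (x != u)]).
apply: eq_card => t; rewrite !inE -topredE /=.
have -> : tval t != [::] by rewrite -size_eq0 size_tuple.
have -> : all [pred x | (c x == j) && (x != u)] t =
    all (fun x => c x == j) t && (u \notin t).
  by rewrite -has_pred1 -all_predC -all_predI.
by case: (all _ t); case: (u \in t); case: uniq.
Qed.

Let n := #|class_set c j|.
Let e := w * n%:R * \sum_(l < k) (n%:R * p) ^+ l.

Lemma reach_bounds (b M : R) (K := \sum_(l < k.+1) l%:R * (k.+1%:R + M) ^+ l) :
  p <= b -> q <= b -> b <= 1 -> #|T|%:R * b <= M -> (0 < n)%N ->
  e * (1 - (k%:R ^+ 2 / n%:R + K * b)) <=
    sbm_expect c p q (fun G => #|homo_nbrs c G u k :&: class_set c j|%:R) <= e.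
Proof.
move=> pb qb b1 bM n0; have /andP[p0 _] := p01; have b0 := le_trans p0 pb.
have M0 : 0 <= M by apply: le_trans bM; rewrite mulr_ge0.
have w0 : 0 <= w by rewrite /w /first_prob; case: ifP => _ //; case/andP: q01.
have K0 : 0 <= K.
  by apply: sumr_ge0 => l _; rewrite mulr_ge0 ?exprn_ge0 ?addr_ge0.
have nN : (n.-1 <= N <= n)%N.
  rewrite /N /n (cardD1 u (class_set c j)).
  have -> : #|[pred x | (c x == j) && (x != u)]| = #|[predD1 class_set c j & u]|.
    by apply: eq_card => x; rewrite !inE andbC.
  by case: (u \in _); rewrite ?add0n ?add1n ?leq_pred ?leqnn ?leqnSn.
have n0' : 0 < n%:R :> R by rewrite ltr0n.
have := expect_reach_bounds c p01 q01 k j u pb qb b1 bM.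
rewrite -/K sum_class_paths; set S := \sum_(l < k) _ => /andP[lo hi].
have Se : S <= e.
  rewrite /S /e mulr_sumr; apply: ler_sum => l _.
  have /andP[_ h] := ffact_bounds R l.+1 n0 nN.
  rewrite (_ : w * _ * _ = n%:R ^+ l.+1 * (w * p ^+ l)).
    by rewrite ler_wpM2r // mulr_ge0 ?exprn_ge0.
  by rewrite exprMn (exprS _ l); ring.
have eS : e * (1 - k%:R ^+ 2 / n%:R) <= S.
  rewrite /S /e mulr_sumr mulr_suml; apply: ler_sum => l _.
  have /andP[h _] := ffact_bounds R l.+1 n0 nN.
  rewrite (_ : w * _ * _ * _ =
    n%:R ^+ l.+1 * (1 - k%:R ^+ 2 / n%:R) * (w * p ^+ l)); last first.
    by rewrite exprMn (exprS _ l); ring.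
  rewrite ler_wpM2r ?mulr_ge0 ?exprn_ge0 // (le_trans _ h) //.
  rewrite ler_wpM2l ?exprn_ge0 // lerD2l lerN2 ler_pM2r ?invr_gt0 //.
  by rewrite lerXn2r ?nnegrE ?ler0n // ler_nat.
rewrite (le_trans hi Se) andbT (le_trans _ lo) //.
(* [S <= e] makes the collision loss relative to [e], so that the two relative losses add up. *)
have : S * (K * b) <= e * (K * b) by rewrite ler_wpM2r // mulr_ge0.
by lra.
Qed.

End Counting.

(** * Stability of quotients and of geometric sums *)

Section Perturbation.
Variable R : realFieldType.

(** An explicit error factor lets the main terms cancel exactly before any estimate. *)
Lemma relative_bound (x X d : R) : 0 < X -> X * (1 - d) <= x <= X ->
  {r | x = X * r & 1 - d <= r <= 1}.
Proof.
move=> X0 /andP[lo hi]; exists (x / X); first by field; rewrite gt_eqF.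
by rewrite ler_pdivlMr // ler_pdivrMr // mul1r mulrC lo.
Qed.

(** Both products lie in [[1 - 2d, 1]], and [d <= 1/4] gives [(1 + 4d)(1 - 2d) >= 1]. *)
Lemma quotient_bound (d r1 r2 r3 r4 : R) : 0 <= d <= 4^-1 ->
  1 - d <= r1 <= 1 -> 1 - d <= r2 <= 1 -> 1 - d <= r3 <= 1 -> 1 - d <= r4 <= 1 ->
  `|r1 * r2 / (r3 * r4) - 1| <= 4 * d.
Proof.
move=> d4 h1 h2 h3 h4.
have lo s t : 1 - d <= s <= 1 -> 1 - d <= t <= 1 -> 1 - 2 * d <= s * t <= 1.
  by move=> hs ht; nra.
have := lo _ _ h1 h2; have := lo _ _ h3 h4.
set x := r1 * r2; set y := r3 * r4 => hy hx.
have y0 : 0 < y by lra.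
rewrite ler_norml lerBrDr lerBlDr ler_pdivlMr // ler_pdivrMr //.
by nra.
Qed.

(** Induction on [x^(l+1) - y^(l+1) = x (x^l - y^l) + (x - y) y^l]; since [1 <= B], the power
    [B ^+ l] may replace [B^(l-1)]. *)
Lemma expr_lipschitz (B x y : R) l : 1 <= B -> 0 <= x <= B -> 0 <= y <= B ->
  `|x ^+ l - y ^+ l| <= l%:R * B ^+ l * `|x - y|.
Proof.
move=> B1 /andP[x0 xB] /andP[y0 yB]; elim: l => [|l IH].
  by rewrite !expr0 subrr normr0 !mul0r.
have B0 : 0 <= B by lra.
have -> : x ^+ l.+1 - y ^+ l.+1 = x * (x ^+ l - y ^+ l) + (x - y) * y ^+ l.
  by rewrite !exprS; ring.
have -> : l.+1%:R * B ^+ l.+1 * `|x - y| =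
    B * (l%:R * B ^+ l * `|x - y|) + `|x - y| * B ^+ l.+1.
  by rewrite -natr1 exprS; ring.
apply: le_trans (ler_normD _ _) _; rewrite !normrM; apply: lerD.
  by rewrite ler_pM // ger0_norm.
rewrite ler_wpM2l // ger0_norm ?exprn_ge0 //.
apply: le_trans (_ : B ^+ l <= _); first by rewrite lerXn2r ?nnegrE.
by rewrite exprS ler_peMl // exprn_ge0.
Qed.

Variable k : nat.
Hypothesis k_gt0 : (0 < k)%N.

Definition geom (x : R) := \sum_(l < k) x ^+ l.

Lemma geom_ge1 x : 0 <= x -> 1 <= geom x.
Proof.
move: k_gt0; rewrite /geom; case: k => // k' _ x0.
by rewrite big_ord_recl expr0 lerDl sumr_ge0 // => l _; rewrite exprn_ge0.
Qed.

Lemma le_geom x y : 0 <= x <= y -> geom x <= geom y.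
Proof.
move=> /andP[x0 xy]; apply: ler_sum => l _; rewrite lerXn2r ?nnegrE //.
exact: le_trans xy.
Qed.

Lemma geom_lipschitz (B x y : R) : 1 <= B -> 0 <= x <= B -> 0 <= y <= B ->
  `|geom x - geom y| <= (\sum_(l < k) l%:R * B ^+ l) * `|x - y|.
Proof.
move=> B1 xB yB; rewrite /geom -sumrB mulr_suml.
apply: le_trans (ler_norm_sum _ _ _) _.
by apply: ler_sum => l _; exact: expr_lipschitz.
Qed.

(** The quantity squared in the limit formula, with [r] the imbalance ratio and [x] either [beta] or
    [n1 p]. *)
Definition amp_ratio (r x : R) := r * geom (r * x) / geom x.

Lemma amp_ratio_bounds (B r x : R) : 1 <= r -> 0 <= x -> r * x <= B ->
  0 <= amp_ratio r x <= r * geom B.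
Proof.
move=> r1 x0 rxB; have rx0 : 0 <= r * x by rewrite mulr_ge0 //; lra.
have g1 := geom_ge1 x0; have g2 := geom_ge1 rx0.
have gB : geom (r * x) <= geom B by rewrite le_geom // rx0.
have x1 : 0 < geom x by lra.
rewrite /amp_ratio; apply/andP; split.
  by rewrite divr_ge0 ?mulr_ge0 //; lra.
rewrite ler_pdivrMr // -mulrA ler_wpM2l //; first by lra.
by apply: (le_trans gB); rewrite ler_peMr //; lra.
Qed.

(** Quotient rule with denominators at least 1. In [r + 1], the [r] comes from the argument [r * x]
    of the numerator and the 1 from the denominator. *)
Lemma amp_ratio_lipschitz (B r x y : R) (L := \sum_(l < k) l%:R * B ^+ l) :
  1 <= B -> 1 <= r -> 0 <= x -> 0 <= y -> r * x <= B -> r * y <= B ->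
  `|amp_ratio r x - amp_ratio r y| <= r * (r + 1) * L * geom B * `|x - y|.
Proof.
move=> B1 r1 x0 y0 rxB ryB; have r0 : 0 <= r by lra.
have rx0 : 0 <= r * x by rewrite mulr_ge0.
have ry0 : 0 <= r * y by rewrite mulr_ge0.
have xB : x <= B by apply: (le_trans _ rxB); rewrite ler_peMl.
have yB : y <= B by apply: (le_trans _ ryB); rewrite ler_peMl.
have gx1 := geom_ge1 x0; have gy1 := geom_ge1 y0.
have gyB : geom y <= geom B by rewrite le_geom // y0.
have gryB : geom (r * y) <= geom B by rewrite le_geom // ry0.
have gry0 := geom_ge1 ry0.
have gxy0 : 0 < geom x * geom y by rewrite mulr_gt0 //; lra.
have -> : amp_ratio r x - amp_ratio r y =
    r * ((geom (r * x) - geom (r * y)) * geom y - geom (r * y) * (geom x - geom y))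
    / (geom x * geom y).
  by rewrite /amp_ratio; field; rewrite !gt_eqF //; lra.
rewrite normrM normfV (ger0_norm (ltW gxy0)) ler_pdivrMr // normrM (ger0_norm r0).
have L0 : 0 <= L by apply: sumr_ge0 => l _; rewrite mulr_ge0 ?exprn_ge0 //; lra.
set t := _ - _; set X := r * (r + 1) * L * geom B * `|x - y|.
suff tX : r * `|t| <= X.
  apply: (le_trans tX); rewrite ler_peMr //.
    by rewrite /X !mulr_ge0 //; lra.
  by apply: mulr_ege1.
rewrite /X -!mulrA ler_wpM2l //.
have l1 := geom_lipschitz B1 (_ : 0 <= r * x <= B) (_ : 0 <= r * y <= B).
have l2 := geom_lipschitz B1 (_ : 0 <= x <= B) (_ : 0 <= y <= B).
rewrite rx0 ry0 rxB ryB x0 y0 xB yB in l1 l2.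
have := l1 isT isT; have := l2 isT isT.
rewrite -mulrBr normrM (ger0_norm r0) -/L => {}l2 {}l1.
have -> : (r + 1) * (L * (geom B * `|x - y|)) =
   L * (r * `|x - y|) * geom B + geom B * (L * `|x - y|) by ring.
apply: le_trans (ler_normB _ _) _; rewrite !normrM; apply: lerD.
  by rewrite ler_pM // ger0_norm //; lra.
by rewrite ler_pM // ger0_norm //; lra.
Qed.

End Perturbation.

(** * Two classes: the four mean counts and the quotient of AMP coefficients *)

Section TwoClasses.
Variables (R : realFieldType) (T : finType) (c : T -> 'I_2) (p q b M : R) (k : nat).
Hypotheses (k_gt0 : (0 < k)%N) (p_gt0 : 0 < p) (q_gt0 : 0 < q).
Hypotheses (p_le_b : p <= b) (q_le_b : q <= b) (b_le1 : b <= 1).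
Hypothesis bM : #|T|%:R * b <= M.

Let n1 := #|class_set c class1|.
Let n2 := #|class_set c class2|.
Hypotheses (n1_gt0 : (0 < n1)%N) (n1_le_n2 : (n1 <= n2)%N).

Let K := \sum_(l < k.+1) l%:R * (k.+1%:R + M) ^+ l.
Let d := k%:R ^+ 2 / n1%:R + K * b.

Let p01 : 0 <= p <= 1. Proof. by rewrite (ltW p_gt0) (le_trans p_le_b). Qed.
Let q01 : 0 <= q <= 1. Proof. by rewrite (ltW q_gt0) (le_trans q_le_b). Qed.
Let n2_gt0 : (0 < n2)%N. Proof. exact: leq_trans n1_le_n2. Qed.
Let rn1_gt0 : 0 < n1%:R :> R. Proof. by rewrite ltr0n. Qed.
Let rn2_gt0 : 0 < n2%:R :> R. Proof. by rewrite ltr0n. Qed.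

Let ord2P (i : 'I_2) : i = class1 \/ i = class2.
Proof. by case: i => -[|[|//]] h; [left|right]; apply: val_inj. Qed.

(** Covers all four pairs of starting class and counted class: [class_meanE] reduces to a fixed [u],
    and with two classes, outside [i] means inside the other. Since [d] is written with the smaller
    size [n1], it is common to all four. *)
Lemma mean_reach_bounds i j u
    (X := if i == j then in_count R c i k else out_count R c i k)
    (n : R := #|class_set c j|%:R)
    (e := (if i == j then p else q) * n * geom k (n * p)) :
  c u = i -> e * (1 - d) <= class_mean c p q i X <= e.
Proof.
move=> cu; have [outE inE'] := class_meanE p q k cu.
have -> : class_mean c p q i X =
    sbm_expect c p q (fun G => #|homo_nbrs c G u k :&: class_set c j|%:R).
  rewrite /X; case: eqP => [<- //|ij]; rewrite outE; apply: eq_bigr => G _.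
  rewrite /out_count; congr (_ * #|pred_of_set _|%:R).
  apply/setP => v; rewrite !inE andbC; congr (_ && _).
  have [-> | ->] := ord2P (c v); have [ie | ie] := ord2P i;
    have [je | je] := ord2P j; rewrite ?ie ?je //; by case: ij; rewrite ie je.
have n1n : n1%:R <= n.
  by rewrite /n ler_nat; have [->|->] := ord2P j.
have n0 : 0 < n := lt_le_trans rn1_gt0 n1n.
have := @reach_bounds R T _ c p q p01 q01 k j u b M p_le_b q_le_b b_le1 bM _.
rewrite /first_prob cu -/K -[#|_|%:R]/n -/(geom _ _) -/e => H.
have nj_gt0 : (0 < #|class_set c j|)%N by rewrite -(ltr0n R).
have /andP[lo ->] := H nj_gt0; rewrite andbT; apply: le_trans lo.
rewrite ler_wpM2l //.
  rewrite /e !mulr_ge0 ?(ltW n0) //; first by case: ifP => _; apply: ltW.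
  by apply: le_trans (geom_ge1 k_gt0 _); rewrite ?mulr_ge0 ?ltW.
rewrite lerD2l lerN2 lerD2r ler_wpM2l ?exprn_ge0 //.
by rewrite lef_pV2.
Qed.

(** With [gi] for [geom k (ni p)], the main terms give [(q n2 g2 / (p n1 g1)) / (q n1 g1 / (p n2
    g2))]: [p] and [q] cancel and the square appears. *)
Lemma amp_quotient_bound (rho := n2%:R / n1%:R : R)
    (A := amp_ratio k rho (n1%:R * p) ^+ 2) : d <= 4^-1 ->
  `|amp c p q class1 k / amp c p q class2 k - A| <= 4 * d * A.
Proof.
move=> d4.
have /card_gt0P[u1] := n1_gt0; have /card_gt0P[u2] := n2_gt0.
rewrite !inE => /eqP cu2 /eqP cu1.
have b0 : 0 <= b := le_trans (ltW p_gt0) p_le_b.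
have M0 : 0 <= M by apply: le_trans bM; rewrite mulr_ge0.
have d0 : 0 <= d.
  rewrite addr_ge0 ?divr_ge0 ?exprn_ge0 ?mulr_ge0 ?sumr_ge0 // => l _.
  by rewrite mulr_ge0 ?exprn_ge0 ?addr_ge0.
have g1 : 0 < geom k (n1%:R * p).
  by apply: lt_le_trans (geom_ge1 k_gt0 _); rewrite ?mulr_ge0 ?ltW.
have g2 : 0 < geom k (n2%:R * p).
  by apply: lt_le_trans (geom_ge1 k_gt0 _); rewrite ?mulr_ge0 ?ltW.
have H11 := mean_reach_bounds class1 cu1; have H12 := mean_reach_bounds class2 cu1.
have H21 := mean_reach_bounds class1 cu2; have H22 := mean_reach_bounds class2 cu2.
rewrite /= -/n1 -/n2 in H11 H12 H21 H22.
have [|r11 E11 B11] := relative_bound _ H11; first by rewrite !mulr_gt0.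
have [|r12 E12 B12] := relative_bound _ H12; first by rewrite !mulr_gt0.
have [|r21 E21 B21] := relative_bound _ H21; first by rewrite !mulr_gt0.
have [|r22 E22 B22] := relative_bound _ H22; first by rewrite !mulr_gt0.
have A0 : 0 <= A by rewrite sqr_ge0.
have -> : amp c p q class1 k / amp c p q class2 k = A * (r12 * r22 / (r11 * r21)).
  rewrite /amp E11 E12 E21 E22 /A /amp_ratio.
  have -> : rho * (n1%:R * p) = n2%:R * p by rewrite /rho; field; rewrite gt_eqF.
  rewrite /rho; field.
  by rewrite ?gt_eqF //=; lra.
rewrite -[X in _ - X]mulr1 -mulrBr normrM (ger0_norm A0) mulrC ler_wpM2r //.
by apply: quotient_bound => //; rewrite d0.
Qed.

End TwoClasses.

(** Non-asymptotic form: [Rm] bounds the imbalance, [Y] both [beta] and [n1 p], [kappa] the ratio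
    [q / p]. With [b := kappa * p], [M <= n] yields [b <= 1] and [4 * D <= n] yields [d <= 1/4]. *)
Lemma amp_quotient_estimate (R : realFieldType) (k : nat) (Rm Y K0 kappa : R)
    (B := Rm * Y) (M := kappa * ((1 + Rm) * Y))
    (D := k%:R ^+ 2 * (1 + Rm) +
       (\sum_(l < k.+1) l%:R * (k.+1%:R + M) ^+ l) * M)
    (L := \sum_(l < k) l%:R * B ^+ l) (G := Rm * geom k B)
    (T : finType) (c : T -> 'I_2) (p q beta : R)
    (n1 := #|class_set c class1|) (n2 := #|class_set c class2|)
    (n : R := #|T|%:R) (rho : R := n2%:R / n1%:R) :
  (0 < k)%N -> (0 < n1)%N -> (n1 < n2)%N -> (n1 + n2)%N = #|T| ->
  0 < p -> 0 < q -> q <= kappa * p -> 1 <= kappa -> rho <= Rm ->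
  1 <= Y -> 0 <= beta <= Y -> n1%:R * p <= Y -> `|n1%:R * p - beta| <= K0 / n ->
  M <= n -> 4 * D <= n ->
  `|amp c p q class1 k / amp c p q class2 k - amp_ratio k rho beta ^+ 2| <=
    (4 * D * G ^+ 2 + Rm * (Rm + 1) * L * geom k B * K0 * (2 * G)) / n.
Proof.
move=> k0 n10 n12 nE p0 q0 qp ka1 rhoR Y1 /andP[be0 beY] pY pbe Mn Dn.
have rn1 : 0 < n1%:R :> R by rewrite ltr0n.
have rn : 0 < n by rewrite ltr0n -nE addn_gt0 n10.
have rho1 : 1 <= rho by rewrite ler_pdivlMr // mul1r ler_nat ltnW.
have R1 : 1 <= Rm by lra.
have M0 : 0 <= M by rewrite !mulr_ge0 //; lra.
(* As [n = n1 (1 + rho)], bounded imbalance makes [1 / n1] of order [1 / n]. *)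
have n1n : (n1%:R)^-1 <= (1 + Rm) / n.
  rewrite ler_pdivlMr // mulrC ler_pdivrMr // mulrDl mul1r /n -nE natrD lerD2l.
  by rewrite -ler_pdivrMr.
have kpn : kappa * p <= M / n.
  rewrite /M -!mulrA ler_wpM2l //; first by lra.
  rewrite (_ : p = (n1%:R)^-1 * (n1%:R * p)); last by field; rewrite gt_eqF.
  rewrite [Y / n]mulrC [leRHS]mulrA; apply: ler_pM => //; rewrite ?invr_ge0 ?mulr_ge0 //; lra.
have kp0 : 0 <= kappa * p by rewrite mulr_ge0 //; lra.
have pk : p <= kappa * p by rewrite ler_peMl // ltW.
have kp1 : kappa * p <= 1.
  by apply: (le_trans kpn); rewrite ler_pdivrMr // mul1r.
have nkp : #|T|%:R * (kappa * p) <= M by rewrite mulrC -ler_pdivlMr.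
have := amp_quotient_bound k0 p0 q0 pk qp kp1 nkp n10 (ltnW n12).
rewrite -/n1 -/n2 -/rho; set S := \sum_(l < k.+1) _; set d := _ + _.
have S0 : 0 <= S.
  by apply: sumr_ge0 => l _; rewrite mulr_ge0 ?exprn_ge0 ?addr_ge0.
have dD : d <= D / n.
  rewrite /d /D -/S mulrDl; apply: lerD; rewrite -[leRHS]mulrA.
    by apply: ler_wpM2l => //; exact: exprn_ge0.
  exact: ler_wpM2l.
have Dn4 : D / n <= 4^-1 by rewrite ler_pdivrMr //; lra.
have B1 : 1 <= B by rewrite /B mulr_ege1.
have x0 : 0 <= n1%:R * p by rewrite mulr_ge0 // ltW.
have rB x : 0 <= x -> x <= Y -> rho * x <= B.
  by move=> ? ?; rewrite /B ler_pM //; lra.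
have gB : 0 <= geom k B by have := geom_ge1 k0 (le_trans ler01 B1); lra.
have boundG x : 0 <= x -> x <= Y -> 0 <= amp_ratio k rho x <= G.
  move=> x00 xY; have /andP[-> h] := amp_ratio_bounds k0 rho1 x00 (rB _ x00 xY).
  by rewrite (le_trans h) // /G ler_wpM2r.
have /andP[ax0 axG] := boundG _ x0 pY.
have /andP[ab0 abG] := boundG _ be0 beY.
have lip := amp_ratio_lipschitz k0 B1 rho1 x0 be0 (rB _ x0 pY) (rB _ be0 beY).
have L0 : 0 <= L by apply: sumr_ge0 => l _; rewrite mulr_ge0 ?exprn_ge0 //; lra.
have {}lip : `|amp_ratio k rho (n1%:R * p) - amp_ratio k rho beta| <=
    Rm * (Rm + 1) * L * geom k B * (K0 / n).
  apply: (le_trans lip); apply: ler_pM => //.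
    by apply: mulr_ge0 => //; apply: mulr_ge0 => //; apply: mulr_ge0; lra.
  by do 2![apply: ler_wpM2r => //]; apply: ler_pM; lra.
move=> /(_ (le_trans dD Dn4)) H.
set x := amp_ratio k rho (n1%:R * p) in H ax0 axG lip *.
set y := amp_ratio k rho beta in ab0 abG lip *.
set Z := amp c p q class1 k / _ in H *.
(* Two errors: from the AMP quotient to the formula at [n1 p], then from [n1 p] to [beta]. *)
rewrite (_ : Z - y ^+ 2 = (Z - x ^+ 2) + (x - y) * (x + y)); last by ring.
apply: (le_trans (ler_normD _ _)); rewrite [leRHS]mulrDl; apply: lerD.
  apply: (le_trans H); rewrite (_ : _ / n = 4 * (D / n) * G ^+ 2); last by ring.
  have Dn0 : 0 <= D / n.
    apply: divr_ge0; last exact: ltW.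
    by rewrite /D -/S addr_ge0 ?mulr_ge0 ?exprn_ge0 //; lra.
  apply: ler_pM; rewrite ?sqr_ge0 ?lerXn2r ?nnegrE //; last by lra.
    by apply: mulr_ge0 => //; rewrite /d addr_ge0 ?(mulr_ge0 S0) // divr_ge0 ?exprn_ge0.
  by apply: ler_wpM2l.
rewrite normrM (_ : _ / n = Rm * (Rm + 1) * L * geom k B * (K0 / n) * (2 * G)); last by ring.
by apply: ler_pM => //; rewrite ger0_norm ?addr_ge0 //; lra.
Qed.

(* The asymptotic statement along a sequence of models *)
From mathcomp Require Import all_classical all_reals all_analysis.

Import numFieldNormedType.Exports.
Local Open Scope classical_set_scope.
Local Open Scope ring_scope.

Lemma near_le_natr (R : realType) (n : nat -> nat) (x : R) :
  n @ \oo --> \oo -> \forall m \near \oo, x <= (n m)%:R.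
Proof.
move=> /cvgnyPge/(_ (Num.bound `|x|)).
apply: filterS => m; rewrite -(ler_nat R); apply: le_trans.
by apply: (le_trans (ler_norm x)); apply/ltW/archi_boundP.
Qed.

Theorem theorem2p1 (R : realType) (k : nat) (beta : R)
  (n n1 n2 : nat -> nat) (c : forall m : nat, 'I_(n m) -> 'I_2)
  (p q rho : nat -> R)
  (k_gt0 : (0 < k)%N)
  (n1E : forall m, #|class_set (c m) class1| = n1 m)
  (n2E : forall m, #|class_set (c m) class2| = n2 m)
  (nE : forall m, (n1 m + n2 m)%N = n m)
  (n1_gt0 : forall m, (0 < n1 m)%N)
  (minority : forall m, (n1 m < n2 m)%N)
  (p01 : forall m, 0 <= p m <= 1)
  (q01 : forall m, 0 <= q m <= 1)
  (rhoE : forall m, rho m = (n2 m)%:R / (n1 m)%:R)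
  (n_infty : n @ \oo --> \oo)
  (rhoO : rho =O_\oo (fun=> 1 : R))
  (n1pO : (fun m => (n1 m)%:R * p m) = (fun=> beta) +O_\oo (fun m => (n m)%:R^-1 : R))
  (pqTheta : (fun m => p m / q m) =Theta_\oo (fun=> 1 : R)) :
  (fun m => amp (c m) (p m) (q m) class1 k / amp (c m) (p m) (q m) class2 k)
  = (fun m => (rho m * (\sum_(1 <= t < k.+1) (rho m * beta) ^+ t.-1)
                     / (\sum_(1 <= t < k.+1) beta ^+ t.-1)) ^+ 2)
  +O_\oo (fun m => (n m)%:R^-1 : R).

Proof.
have [Rm _ near_rho] : exists2 x : R, 0 < x &
    \forall m \near \oo, `|rho m| <= x * `|1 : R|.
  exact: (eqO_exP _ _ _).1 rhoO.
have [K0 K0_gt0 near_beta] : exists2 x : R, 0 < x &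
    \forall m \near \oo, `|(n1 m)%:R * p m - beta| <= x * `|(n m)%:R^-1|.
  exact: (bigO_exP _ _ _).2 ((eqaddOP _ _ _ _).1 n1pO).
(* The Omega half of the Theta bound, which will give [q <= kappa0 * p]. *)
have [kappa0 kappa0_gt0 near_pq] : exists2 x : R, 0 < x &
    \forall m \near \oo, `|1 : R| <= x * `|p m / q m|.
  apply/(eqO_exP _ _ _).1; rewrite -eqOmegaO.
  by move: pqTheta; rewrite eqThetaE bigThetaE => -[].
(* A negative [beta] would stay at distance at least [- beta] from [n1 p >= 0], which exceeds
   [K0 / n] for large [n]. *)
have beta_ge0 : 0 <= beta.
  rewrite leNgt; apply/negP => beta_lt0.
  have [m [mbeta mn]] := filter_ex (filterI near_beta
    (near_le_natr ((K0 + 1) / - beta) n_infty)).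
  have n_gt0 : 0 < (n m)%:R :> R by rewrite ltr0n -nE addn_gt0 n1_gt0.
  have yp : 0 <= (n1 m)%:R * p m by rewrite mulr_ge0 //; case/andP: (p01 m).
  move: mbeta mn; rewrite /= normfV (ger0_norm (ltW n_gt0)).
  rewrite ger0_norm; last by lra.
  rewrite ler_pdivlMr // ler_pdivrMr ?oppr_gt0 //.
  by have := mulr_ge0 yp (ltW n_gt0); rewrite mulrBl mulrN [_ * beta]mulrC; lra.
(* [beta + K0] bounds [n1 p] because [n >= 1]; the added 1 ensures [1 <= kappa] and [1 <= Y]. *)
pose kappa := kappa0 + 1; pose Y := beta + K0 + 1.
pose B := Rm * Y; pose M := kappa * ((1 + Rm) * Y).
pose D := k%:R ^+ 2 * (1 + Rm) + (\sum_(l < k.+1) l%:R * (k.+1%:R + M) ^+ l) * M.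
apply/eqaddOP/bigO_exP.
pose L := \sum_(l < k) l%:R * B ^+ l; pose G := Rm * geom k B.
pose E := 4 * D * G ^+ 2 + Rm * (Rm + 1) * L * geom k B * K0 * (2 * G).
(* A positive constant above [E], whatever the sign of [E]. *)
exists (`|E| + 1); first by rewrite ltr_pwDr.
near=> m.
have n_gt0 : 0 < (n m)%:R :> R by rewrite ltr0n -nE addn_gt0 n1_gt0.
have pq_ge1 : 1 <= kappa0 * `|p m / q m|.
  by rewrite -[leLHS]normr1; near: m; exact: near_pq.
have /andP[p0 p1] := p01 m; have /andP[q0 q1] := q01 m.
(* If [q] were 0, then [p / q] would be 0 by the convention on inverses, against [pq_ge1]. *)
have q_neq0 : q m != 0.
  by apply: contraTneq pq_ge1 => ->; rewrite invr0 mulr0 normr0 mulr0 ler10.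
have q_gt0 : 0 < q m by rewrite lt_def q_neq0.
have qp : q m <= kappa0 * p m.
  by move: pq_ge1; rewrite ger0_norm ?divr_ge0 // mulrA ler_pdivlMr // mul1r.
have p_gt0 : 0 < p m by rewrite -(pmulr_rgt0 _ kappa0_gt0); apply: lt_le_trans qp.
have rhoR : rho m <= Rm.
  apply: (le_trans (ler_norm _)); rewrite -[leRHS]mulr1 -[X in _ * X]normr1.
  by near: m; exact: near_rho.
have n1p : `|(n1 m)%:R * p m - beta| <= K0 / (n m)%:R.
  rewrite -[X in _ / X]ger0_norm ?(ltW n_gt0) // -normfV.
  by near: m; exact: near_beta.
have n_ge1 : 1 <= (n m)%:R :> R by rewrite ler1n -nE addn_gt0 n1_gt0.
have n1pY : (n1 m)%:R * p m <= beta + K0.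
  rewrite -lerBlDl (le_trans (ler_norm _)) // (le_trans n1p) //.
  by rewrite ler_pdivrMr // ler_peMr // ltW.
have geomE x : \sum_(1 <= t < k.+1) x ^+ t.-1 = geom k x :> R.
  by rewrite big_add1 /= big_mkord.
have /= H := @amp_quotient_estimate R k Rm Y K0 kappa _ (c m) (p m) (q m) beta.
rewrite n1E n2E card_ord -rhoE in H.
rewrite !fctE !geomE -/(amp_ratio k (rho m) beta).
apply: (@le_trans _ _ (E / (n m)%:R)).
  apply: H => //.
  - by rewrite (le_trans qp) // /kappa mulrDl mul1r lerDl.
  - by rewrite /kappa; lra.
  - by rewrite /Y; lra.
  - by rewrite beta_ge0 /Y; lra.
  - by rewrite /Y; lra.
  - by near: m; exact: near_le_natr.
  - by near: m; exact: near_le_natr.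
rewrite normfV (ger0_norm (ltW n_gt0)) ler_wpM2r ?invr_ge0 ?(ltW n_gt0) //.
by apply: (le_trans (ler_norm _)); rewrite lerDl.
Unshelve. all: by end_near.
Qed.
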